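(* For any purely path dependent model that generates a sequence $\{Y_n\}$, there exists a time-varying talent model generating a sequence $\{Y'_n\}$ that has the same joint distribution as $\{Y_n\}$.
   Context: Purely path dependent model: a model with no notion of talent, generating a sequence of observations $\{Y_n\}_{n\ge1}$ (not required to be real-valued) in which the $n$-th observation depends on luck and on the values of the previous observations, that is, $Y_n=g_n(Y_1,\ldots,Y_{n-1},X_n)$ for all $n\ge1$ (so $Y_1=g_1(X_1)$). Here $\{X_n\}_{n\ge1}$ is an i.i.d. sequence and each $g_n$ can be any measurable function. Time-varying talent model: a model generating a sequence of observations $\{Y_n\}_{n\ge1}$ of the form $Y_n=f_n(T,X_n)$ for all $n\ge1$. Here $T$ (the ''talent'') is a random variable drawn from a fixed distribution, $\{X_n\}_{n\ge1}$ (the chance or ''luck'' components) is a sequence of i.i.d. random variables independent of $T$, and $\{f_n\}_{n\ge1}$ is a sequence of functions, which can be any measurable functions and may vary with $n$. The i.i.d. sequences used in the two models need not be the same. ''Same joint distribution'' refers to the distributions of the entire sequences, not only of their individual terms. *)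

(* Defs.v *)
From HB Require Import structures.
From mathcomp Require Import all_boot all_order all_algebra finmap.
From mathcomp Require Import all_classical all_reals all_analysis.

Set Implicit Arguments.
Unset Strict Implicit.
Unset Printing Implicit Defensive.

Local Open Scope classical_set_scope.

(* The countable power of S with its product sigma-algebra, that is, the one
   generated by the coordinate projections. *)
Definition seqspace d (S : measurableType d) :=
  g_sigma_algebraType
    (\bigcup_n preimage_set_system setT (fun u : nat -> S => u n) measurable).

Definition trajectory (Omega : Type) d (S : measurableType d)
  (Y : nat -> Omega -> S) : Omega -> seqspace S := fun w n => Y n w.

Section models.
Local Open Scope ereal_scope.
Context {R : realType} {d : measure_display} {Omega : measurableType d}
  (P : probability Omega R).

Definition mutually_independent dE (E : measurableType dE)
    (X : nat -> {RV P >-> E}) : Prop :=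
  forall (J : {fset nat}) (A : nat -> set E), (forall n, measurable (A n)) ->
    P (\bigcap_(n in [set` J]) (X n @^-1` A n)) =
    \prod_(n <- J) P (X n @^-1` A n).

Definition identically_distributed dE (E : measurableType dE)
    (X : nat -> {RV P >-> E}) : Prop :=
  forall (m n : nat) (A : set E), measurable A ->
    distribution P (X m) A = distribution P (X n) A.

Definition iid dE (E : measurableType dE) (X : nat -> {RV P >-> E}) : Prop :=
  mutually_independent X /\ identically_distributed X.

(* T is independent of the whole sequence X, not only of each X n. *)
Definition independent_of_sequence dT (TT : measurableType dT)
    dE (E : measurableType dE)
    (T : {RV P >-> TT}) (X : nat -> {RV P >-> E}) : Prop :=
  forall (A : set TT) (B : set (seqspace E)), measurable A -> measurable B ->
    P (T @^-1` A `&` trajectory X @^-1` B) =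
    P (T @^-1` A) * P (trajectory X @^-1` B).

(* Indices start at 0: Y n is the (n+1)-st observation, so that exactly the n
   observations Y 0, ..., Y n.-1 precede it. *)
Definition path_dependent_model dE (E : measurableType dE)
    dS (S : measurableType dS) (X : nat -> {RV P >-> E})
    (g : forall n : nat, n.-tuple S * E -> S) (Y : nat -> Omega -> S) : Prop :=
  [/\ iid X,
      forall n, measurable_fun setT (g n) &
      forall n w, Y n w = g n ([tuple Y i w | i < n], X n w)].

Definition time_varying_talent_model dT (TT : measurableType dT)
    dE (E : measurableType dE) dS (S : measurableType dS)
    (T : {RV P >-> TT}) (X : nat -> {RV P >-> E})
    (f : nat -> TT * E -> S) (Y : nat -> Omega -> S) : Prop :=
  [/\ iid X,
      independent_of_sequence T X,
      forall n, measurable_fun setT (f n) &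
      forall n w, Y n w = f n (T w, X n w)].

End models.

Definition same_joint_distribution (R : realType)
    d1 (Omega1 : measurableType d1) (P1 : probability Omega1 R)
    d2 (Omega2 : measurableType d2) (P2 : probability Omega2 R)
    dS (S : measurableType dS)
    (Y1 : nat -> Omega1 -> S) (Y2 : nat -> Omega2 -> S) : Prop :=
  forall B : set (seqspace S), measurable B ->
    pushforward P1 (trajectory Y1) B = pushforward P2 (trajectory Y2) B.

(* Main.v *)
Require Import Defs.
From HB Require Import structures.
From mathcomp Require Import all_boot all_order all_algebra finmap.
From mathcomp Require Import all_classical all_reals all_analysis.

(** Since the talent may take values in an arbitrary measurable space, it can
    record everything that ever happens.  Take the talent to be the whole
    trajectory of the path dependent model, a random element of the sequence
    space, and let the [n]-th observation read off its [n]-th coordinate.  The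
    luck then has nothing left to contribute and may be a constant sequence,
    which is i.i.d. ([iid_cst]) and independent of every random variable
    ([independent_of_sequence_cst]).  The new observations are equal to the old
    ones, pointwise and on the same probability space, so the two sequences
    have the same law.

    What has to be checked is that the trajectory is a random variable at all.
    The recursion [Y n = g n (Y 0, ..., Y n.-1, X n)] composes measurable maps,
    so each observation is measurable by strong induction
    ([measurable_path_dependent]); and a map into the sequence space is
    measurable as soon as its coordinates are ([measurable_trajectory]). *)

Local Open Scope classical_set_scope.

Lemma measurable_trajectory {d dS : measure_display} {Omega : measurableType d}
    {S : measurableType dS} (Y : nat -> Omega -> S) :
  (forall n, measurable_fun [set: Omega] (Y n)) ->
  measurable_fun [set: Omega] (trajectory Y).
Proof.
move=> mY; apply: measurability; first by [].
move=> _ [_ [n _ [A mA <-]] <-]; rewrite setTI preimage_setI preimage_setT.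
exact: mY.
Qed.

Lemma measurable_coordinate {dS : measure_display} {S : measurableType dS}
    (n : nat) :
  measurable_fun [set: seqspace S] (fun u : seqspace S => u n).
Proof.
move=> _ A mA; apply: sub_sigma_algebra.
by exists n => //; exists A.
Qed.

Lemma measurable_path_dependent {R : realType} {d dE dS : measure_display}
    {Omega : measurableType d} {P : probability Omega R}
    {E : measurableType dE} {S : measurableType dS} {X : nat -> {RV P >-> E}}
    {g : forall n : nat, n.-tuple S * E -> S} {Y : nat -> Omega -> S} :
  path_dependent_model X g Y -> forall n, measurable_fun [set: Omega] (Y n).
Proof.
move=> [_ mg YE]; elim/ltn_ind => n IHn.
have -> : Y n = g n \o (fun w => ([tuple Y i w | i < n], X n w)).
  by apply/funext => w; rewrite YE.
apply: measurableT_comp (mg n) _; apply: measurable_fun_pair => //.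
apply/measurable_fun_tnthP => i.
rewrite (_ : _ \o _ = Y i); first exact: IHn.
by apply/funext => w /=; rewrite tnth_mktuple.
Qed.

Section constant_sequence.
Context {R : realType} {d dE : measure_display} {Omega : measurableType d}
  (P : probability Omega R) {E : measurableType dE} (e : E).

Let X : nat -> {RV P >-> E} := fun=> cst e.

(** Every event about a constant is sure or impossible. *)
Lemma iid_cst : iid X.
Proof.
split=> [J A mA|//].
have [[n [nJ Ane]]|allA] := pselect (exists n, n \in J /\ ~ A n e).
  (* One impossible event makes the intersection empty and the product 0. *)
  have XA0 : X n @^-1` A n = set0 by rewrite -subset0 => w.
  rewrite (bigD1_seq n) //= XA0 measure0 mul0e.
  rewrite (_ : \bigcap_(_ in _) _ = set0) ?measure0 //.
  by rewrite -subset0 => w /(_ n nJ).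
have XAT n : n \in J -> X n @^-1` A n = setT.
  move=> nJ; rewrite -subTset => w _.
  by apply: contrapT => nAe; apply: allA; exists n.
rewrite big_seq big1 => [|n nJ]; last by rewrite XAT // probability_setT.
by rewrite bigcapT ?probability_setT // => n nJ; exact: XAT.
Qed.

Lemma independent_of_sequence_cst {dT : measure_display}
    {TT : measurableType dT} (T : {RV P >-> TT}) :
  independent_of_sequence T X.
Proof.
move=> A B mA mB.
have -> : trajectory X = cst (fun=> e) by [].
rewrite preimage_cst; case: ifPn => _.
  by rewrite setIT probability_setT mule1.
by rewrite setI0 measure0 mule0.
Qed.

End constant_sequence.

Theorem theorem5 (R : realType)
    (d : measure_display) (Omega : measurableType d) (P : probability Omega R)
    (dE : measure_display) (E : measurableType dE)
    (dS : measure_display) (S : measurableType dS)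
    (X : nat -> {RV P >-> E}) (g : forall n : nat, n.-tuple S * E -> S)
    (Y : nat -> Omega -> S) (HY : path_dependent_model X g Y) :
  exists (d' : measure_display) (Omega' : measurableType d')
    (P' : probability Omega' R)
    (dT : measure_display) (TT : measurableType dT)
    (dE' : measure_display) (E' : measurableType dE')
    (T : {RV P' >-> TT}) (X' : nat -> {RV P' >-> E'})
    (f : nat -> TT * E' -> S) (Y' : nat -> Omega' -> S),
    time_varying_talent_model T X' f Y' /\
    same_joint_distribution P P' Y Y'.
Proof.
have mY := measurable_trajectory Y (measurable_path_dependent HY).
pose T : {RV P >-> seqspace S} := mfun_Sub (mem_set mY).
exists d, Omega, P, _, (seqspace S), _, unit, T, (fun=> cst tt).
exists (fun n p => p.1 n), Y; split=> //; split=> //.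
- exact: iid_cst.
- exact: independent_of_sequence_cst.
- by move=> n; apply: measurableT_comp (measurable_coordinate n) _.
Qed.
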